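(* Assume that there exist $\omega<0$ and a positive constant $C$ such that $$\|\nabla G(t,s)f\|_\infty\le Ce^{\omega(t-s)}\|f\|_\infty$$ for all $s\in I$, all $t\ge s+1$ and all $f\in C_b(\mathbb{R}^d)$. Assume also that $\{G(t,s)\}$ admits an evolution system of measures $(\mu_t)_{t\in I}$ such that $\lim_{t\to+\infty}\mu_t(p)e^{\omega pt}=0$ for some $p>0$, where $\mu_t(p):=\int_{\mathbb{R}^d}|x|^p\,\mu_t(dx)$. Then there exists at most one evolution system of measures $(\mu_t)_{t\in I}$ for $\{G(t,s)\}$ such that $\lim_{t\to+\infty}\mu_t(p)e^{\omega pt}=0$ for some $p>0$.
   Context: $d\ge 1$ is an integer and $I\subset\mathbb{R}$ is an interval which is either $\mathbb{R}$ or a right halfline. For $t\in I$ and smooth $\varphi:\mathbb{R}^d\to\mathbb{R}$, $$(\mathcal{A}(t)\varphi)(x)=\sum_{i,j=1}^d q_{ij}(t,x)D_{ij}\varphi(x)+\sum_{i=1}^d b_i(t,x)D_i\varphi(x),$$ with $Q=(q_{ij})$, $b=(b_i)$. Standing assumptions: (1) for some $\alpha\in(0,1)$, all $q_{ij},b_i$ belong to $C^{\alpha/2,\alpha}_{\rm loc}(I\times\mathbb{R}^d)$, i.e. they are $\alpha$-Hölder continuous with respect to the parabolic distance on every compact subset of $I\times\mathbb{R}^d$; (2) for every $(t,x)\in I\times\mathbb{R}^d$ the matrix $Q(t,x)$ is symmetric, and there is a function $\eta:I\times\mathbb{R}^d\to\mathbb{R}$ with $0<\eta_0:=\inf_{I\times\mathbb{R}^d}\eta$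 and $\langle Q(t,x)\xi,\xi\rangle\ge\eta(t,x)|\xi|^2$ for all $\xi\in\mathbb{R}^d$, $(t,x)\in I\times\mathbb{R}^d$; (3) for every bounded interval $J\subset I$ there exist $\varphi=\varphi_J\in C^2(\mathbb{R}^d)$ and $\lambda=\lambda_J>0$ such that $\lim_{|x|\to+\infty}\varphi(x)=+\infty$ and $(\mathcal{A}(t)\varphi)(x)-\lambda\varphi(x)\le0$ for $(t,x)\in J\times\mathbb{R}^d$. Under (1)-(3), for every $s\in I$ and $f\in C_b(\mathbb{R}^d)$ (bounded continuous functions, sup-norm $\|\cdot\|_\infty$) there is a unique bounded classical solution $u_f\in C_b([s,+\infty)\times\mathbb{R}^d)\cap C^{1,2}((s,+\infty)\times\mathbb{R}^d)$ of $u_t=\mathcal{A}(t)u$ in $(s,+\infty)\times\mathbb{R}^d$, $u(s,\cdot)=f$; for $t>s$, $(G(t,s)f)(x)=u_f(t,x)$, and $G(t,t)=\mathrm{id}$. There are unique Borel probability measures $p_{t,s}(x,\cdot)$ with $(G(t,s)f)(x)=\int_{\mathbb{R}^d}f(y)\,p_{t,s}(x,dy)$ for $f\in C_b(\mathbb{R}^d)$, and by this formula $G(t,s)$ is extended to the space $B_b(\mathbb{R}^d)$ of bounded Borel functions. An evolution system of measures for $\{G(t,s)\}$ is a family $(\nu_t)_{t\in I}$ of Borel probability measures on $\mathbb{R}^d$ such that $\int_{\mathbb{R}^d}G(t,s)f\,d\nu_t=\int_{\mathbb{R}^d}f\,d\nu_s$ for every $f\in B_b(\mathbb{R}^d)$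 and every $s<t$ in $I$. $\|\nabla g\|_\infty=\sup_x|\nabla g(x)|$. *)

(* Defs.v *)
From HB Require Import structures.
From mathcomp Require Import all_boot all_order all_algebra.
From mathcomp Require Import all_classical all_reals all_analysis.

Set Implicit Arguments.
Unset Strict Implicit.
Unset Printing Implicit Defensive.

Import Order.TTheory GRing.Theory Num.Theory.
Import numFieldNormedType.Exports.

Local Open Scope classical_set_scope.
Local Open Scope ring_scope.

(* R^d with its Borel sigma-algebra; as a type it is convertible to 'rV[R]_d. *)
Notation borelRd R d := (g_sigma_algebraType (@open 'rV[R]_d)).

Section Defs.
Variables (R : realType) (d : nat).
Local Notation E := 'rV[R]_d.

(* The library norm `|x| on 'rV[R]_d is the sup norm; the Euclidean one is needed. *)
Definition enorm (x : E) : R := Num.sqrt (\sum_(i < d) x 0 i ^+ 2).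

Definition basis_vec (i : 'I_d) : E := delta_mx 0 i.

Definition pd1 (i : 'I_d) (f : E -> R) : E -> R := 'D_(basis_vec i) f.

Definition pd2 (i j : 'I_d) (f : E -> R) : E -> R := pd1 i (pd1 j f).

Definition gradient (f : E -> R) (x : E) : E := \row_i pd1 i f x.

(* Extended-real valued, so that the sup of an unbounded function is +oo. *)
Definition sup_norm (f : E -> R) : \bar R :=
  ereal_sup [set (`|f x|)%:E | x in [set: E]].

Definition sup_grad (f : E -> R) : \bar R :=
  ereal_sup [set (enorm (gradient f x))%:E | x in [set: E]].

Definition Cb (f : E -> R) : Prop :=
  continuous f /\ exists M : R, forall x, `|f x| <= M.

Definition Bb (f : E -> R) : Prop :=
  measurable_fun [set: borelRd R d] (f : borelRd R d -> R) /\
  exists M : R, forall x, `|f x| <= M.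

Definition C2 (f : E -> R) : Prop :=
  [/\ continuous f,
      forall i x, derivable f x (basis_vec i),
      forall i, continuous (pd1 i f),
      forall i j x, derivable (pd1 j f) x (basis_vec i) &
      forall i j, continuous (pd2 i j f)].

Definition C12 (D : set R) (u : R -> E -> R) : Prop :=
  let cont (g : R -> E -> R) :=
    {within D `*` [set: E], continuous (fun z : R * E => g z.1 z.2)} in
  [/\ forall t x, D t ->
        [/\ derivable (u ^~ x) t 1,
            forall i, derivable (u t) x (basis_vec i) &
            forall i j, derivable (pd1 j (u t)) x (basis_vec i)],
      cont u,
      cont (fun t x => derive1 (u ^~ x) t),
      forall i, cont (fun t => pd1 i (u t)) &
      forall i j, cont (fun t => pd2 i j (u t))].

Definition line_or_right_halfline (I : set R) : Prop :=
  I = [set: R] \/ exists a : R, I = [set` `[a, +oo[] \/ I = [set` `]a, +oo[].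

Definition parabolic_dist (z w : R * E) : R :=
  enorm (z.2 - w.2) + Num.sqrt `|z.1 - w.1|.

Definition parabolic_holder_loc (I : set R) (alpha : R) (g : R -> E -> R) :
    Prop :=
  forall K : set (R * E), compact K -> K `<=` I `*` [set: E] ->
  exists H : R, forall z w, K z -> K w ->
    `|g z.1 z.2 - g w.1 w.2| <= H * parabolic_dist z w `^ alpha.

Section Operator.
Variables (q : R -> E -> 'M[R]_d) (b : R -> E -> E).

Definition Aop (t : R) (phi : E -> R) (x : E) : R :=
  \sum_(i < d) \sum_(j < d) q t x i j * pd2 i j phi x
  + \sum_(i < d) b t x 0 i * pd1 i phi x.

Definition holder_coefficients (I : set R) : Prop :=
  exists2 alpha : R, 0 < alpha < 1 &
    (forall i j, parabolic_holder_loc I alpha (fun t x => q t x i j)) /\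
    (forall i, parabolic_holder_loc I alpha (fun t x => b t x 0 i)).

Definition uniformly_elliptic (I : set R) : Prop :=
  (forall t x, I t -> (q t x)^T = q t x) /\
  exists eta : R -> E -> R,
    (0 < ereal_inf [set (eta z.1 z.2)%:E | z in I `*` [set: E]])%E /\
    forall t x (xi : E), I t ->
      eta t x * enorm xi ^+ 2
        <= \sum_(i < d) (\sum_(j < d) q t x i j * xi 0 j) * xi 0 i.

Definition lyapunov_condition (I : set R) : Prop :=
  forall J : set R, is_interval J -> bounded_set J -> J `<=` I ->
  exists (phi : E -> R) (lambda : R),
    [/\ C2 phi, 0 < lambda,
        forall M : R, exists r : R, forall x, r <= enorm x -> M <= phi x &
        forall t x, J t -> Aop t phi x - lambda * phi x <= 0].

Definition bounded_classical_solution (s : R) (f : E -> R) (u : R -> E -> R) :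
    Prop :=
  [/\ {within [set` `[s, +oo[] `*` [set: E], continuous (fun z : R * E => u z.1 z.2)},
      exists M : R, forall t x, s <= t -> `|u t x| <= M,
      C12 [set` `]s, +oo[] u,
      forall t x, s < t -> derive1 (u ^~ x) t = Aop t (u t) x &
      u s = f].

(* [G t s f] is G(t,s)f. On C_b it is given by the bounded classical solution
   of the Cauchy problem and on B_b by the kernels p_{t,s}(x,.), written
   [P t s x]; in particular [P] also represents G(t,s) on C_b. Existence and
   uniqueness of such a [G] (for s in I, t >= s, f in B_b) is the
   well-posedness theorem for the operators A(t). Values of [G] at other
   arguments are irrelevant. *)
Definition evolution_operator (I : set R)
    (G : R -> R -> (E -> R) -> (E -> R)) : Prop :=
  (forall s f, I s -> Cb f ->
     bounded_classical_solution s f (fun t => G t s f)) /\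
  exists P : R -> R -> E -> probability (borelRd R d) R,
    forall s t x f, I s -> s <= t -> Bb f ->
      (G t s f x)%:E = (\int[P t s x]_y (f y)%:E)%E.

End Operator.

(* Only the measures [mu t] with [t] in [I] matter. *)
Definition evolution_system_of_measures (I : set R)
    (G : R -> R -> (E -> R) -> (E -> R))
    (mu : R -> probability (borelRd R d) R) : Prop :=
  forall s t f, I s -> I t -> s < t -> Bb f ->
    (\int[mu t]_x (G t s f x)%:E = \int[mu s]_x (f x)%:E)%E.

(* Possibly +oo. *)
Definition moment (m : probability (borelRd R d) R) (p : R) : \bar R :=
  (\int[m]_x (enorm x `^ p)%:E)%E.

Definition moment_decay (omega : R) (mu : R -> probability (borelRd R d) R) :
    Prop :=
  exists2 p : R, 0 < p &
    (moment (mu t) p * (expR (omega * p * t))%:E)%E @[t --> +oo] --> 0%E.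

End Defs.

(* Main.v *)
Require Import Defs.
From HB Require Import structures.
From mathcomp Require Import all_boot all_order all_algebra.
From mathcomp Require Import all_classical all_reals all_analysis.
From mathcomp Require Import measurable_realfun ring lra.

Set Implicit Arguments.
Unset Strict Implicit.
Unset Printing Implicit Defensive.

Import Order.TTheory GRing.Theory Num.Theory.
Import numFieldNormedType.Exports.

Local Open Scope classical_set_scope.
Local Open Scope ring_scope.

(* For f in C_b and t >= s + 1, the function G(t,s)f is bounded by some N and,
   by the gradient estimate, Lipschitz with constant K_t = O(e^(omega t)), so
   |G(t,s)f(x) - G(t,s)f(0)| <= min(2N, K_t |x|) <= eps + 2N (K_t |x| / eps)^p.
   Integrating against mu_t, the moment decay shows that the integral of f
   against mu_s, which is that of G(t,s)f against mu_t, is asymptotic to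
   G(t,s)f(0) as t -> +oo. The latter does not depend on mu, so two such systems
   agree on C_b, and hence on all Borel sets. *)

(** * Lipschitz bounds from bounds on the partial derivatives *)

Section Estimates.
Context {R : realType} {d : nat}.
Local Notation E := 'rV[R]_d.

Lemma normr_coord_le_enorm (x : E) (i : 'I_d) : `|x 0 i| <= enorm x.
Proof.
rewrite /enorm -sqrtr_sqr ler_sqrt ?sumr_ge0// => [|j _]; last exact: sqr_ge0.
by rewrite (bigD1 i)//= lerDl sumr_ge0// => j _; exact: sqr_ge0.
Qed.

Lemma enorm_ge0 (x : E) : 0 <= enorm x.
Proof. exact: sqrtr_ge0. Qed.

Lemma is_derive_along_line (g : E -> R) (x v : E) (t : R) :
  derivable g (x + t *: v) v ->
  is_derive t 1 (fun r => g (x + r *: v)) ('D_v g (x + t *: v)).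
Proof.
have quotE : (fun h : R => h^-1 *:
      (((fun r => g (x + r *: v)) \o shift t) (h *: 1) - g (x + t *: v))) =
    (fun h : R => h^-1 *: ((g \o shift (x + t *: v)) (h *: v) - g (x + t *: v))).
  apply/funext => h /=; congr (_ *: (g _ - _)).
  by rewrite [h *: 1]mulr1 scalerDl addrCA.
by move=> dg; apply: DeriveDef; rewrite /derivable /derive quotE.
Qed.

(** Mean value theorem on [[0, t]]; for negative [t], the segment is run backwards from
    [x + t *: v]. *)
Lemma lipschitz_along_line (g : E -> R) (v : E) (L : R) :
  (forall x, derivable g x v) -> (forall x, `|'D_v g x| <= L) ->
  forall x t, `|g (x + t *: v) - g x| <= L * `|t|.
Proof.
move=> dg gL.
have main x t : 0 <= t -> `|g (x + t *: v) - g x| <= L * `|t|.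
  move=> t0; have gD (r : R) := is_derive_along_line (dg (x + r *: v)).
  have gC : {within `[0, t], continuous (fun r => g (x + r *: v))}.
    by apply: derivable_within_continuous => r _; case: (gD r).
  have [c _] := MVT_segment t0 (fun r _ => gD r) gC.
  by rewrite scale0r addr0 subr0 => ->; rewrite normrM ler_wpM2r.
move=> x t; have [/main//|/ltW t0] := leP 0 t.
have := main (x + t *: v) (- t); rewrite oppr_ge0 => /(_ t0).
by rewrite scaleNr addrK distrC normrN.
Qed.

(** Only directional derivatives along the axes are at hand, so [x] is reached from [0] by changing
    one coordinate at a time. Each of the [d] changes costs at most [L * enorm x], whence the factor
    [d]. *)
Lemma lipschitz_of_partials (g : E -> R) (L : R) :
  (forall i x, derivable g x (basis_vec R i)) ->
  (forall i x, `|pd1 i g x| <= L) ->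
  forall x, `|g x - g 0| <= d%:R * L * enorm x.
Proof.
move=> dg gL x.
(* [z k] keeps the first [k] coordinates of [x], so [z 0 = 0] and [z d = x]. *)
pose z k : E := \row_(i < d) (if (i < k)%N then x 0 i else 0).
have step k : (k <= d)%N -> `|g (z k) - g 0| <= k%:R * (L * enorm x).
  elim: k => [_|k IHk kd].
    rewrite (_ : z 0%N = 0) ?subrr ?normr0 ?mul0r//.
    by apply/rowP => i; rewrite !mxE.
  pose i := Ordinal kd.
  have -> : z k.+1 = z k + x 0 i *: basis_vec R i.
    apply/rowP => j; rewrite !mxE eqxx/= ltnS leq_eqVlt.
    have [->|ji] := eqVneq j i; first by rewrite !eqxx ltnn/= mulr1 add0r.
    rewrite [(j : nat) == k](_ : _ = false) ?mulr0 ?addr0//.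
    by apply: contraNF ji => /eqP jk; apply/eqP/val_inj.
  rewrite -(subrK (g (z k)) (g (_ + _))) -addrA -natr1 mulrDl mul1r addrC.
  rewrite (le_trans (ler_normD _ _))// lerD ?IHk ?(ltnW kd)//.
  rewrite (le_trans (lipschitz_along_line (dg i) (gL i) _ _))//.
  rewrite ler_wpM2l ?normr_coord_le_enorm//.
  exact: le_trans (normr_ge0 _) (gL i 0).
have := step d (leqnn d); rewrite mulrA (_ : z d = x)//.
by apply/rowP => i; rewrite mxE ltn_ord.
Qed.

Lemma sup_norm_le (f : E -> R) (M : R) :
  (forall x, `|f x| <= M) -> (sup_norm f <= M%:E)%E.
Proof. by move=> fM; apply: ge_ereal_sup => _ [x _ <-]; rewrite lee_fin. Qed.

Lemma partial_le_sup_grad (g : E -> R) (L : R) : (sup_grad g <= L%:E)%E ->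
  forall i x, `|pd1 i g x| <= L.
Proof.
move=> gL i x.
have := normr_coord_le_enorm (gradient g x) i; rewrite mxE => /le_trans; apply.
by rewrite -lee_fin (le_trans _ gL)//; apply: ereal_sup_ubound; exists x.
Qed.

(* If [K r <= eps] the first summand suffices; otherwise [(K r / eps) `^ p >= 1]. *)
Lemma min_le_powR (p eps M K r D : R) :
  0 < p -> 0 < eps -> 0 <= M -> 0 <= K -> 0 <= r -> D <= M -> D <= K * r ->
  D <= eps + M * (K / eps) `^ p * r `^ p.
Proof.
move=> p0 e0 M0 K0 r0 DM DK; have [Ke|eK] := leP (K * r) eps.
  rewrite (le_trans DK)// (le_trans Ke)// lerDl.
  by rewrite !mulr_ge0 ?powR_ge0.
rewrite (le_trans DM)// -[leLHS]add0r lerD ?(ltW e0)// -mulrA ler_peMr//.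
have one_powR : 1 `^ p = 1 :> R by rewrite powR1.
rewrite -powRM ?divr_ge0 ?(ltW e0)// -[leLHS]one_powR.
rewrite ge0_ler_powR ?nnegrE ?mulr_ge0 ?divr_ge0 ?invr_ge0 ?(ltW p0) ?(ltW e0)//.
by rewrite mulrAC ler_pdivlMr// mul1r ltW.
Qed.

End Estimates.

(** * Borel probability measures are determined by their integrals on $C_b$ *)

Section Measures.
Context {R : realType} {d : nat}.
Local Notation E := 'rV[R]_d.
Local Notation B := (borelRd R d).

Lemma measurable_fun_continuous (f : E -> R) :
  continuous f -> measurable_fun [set: B] (f : B -> R).
Proof.
move=> /continuousP cf; apply: (measurability _ (RGenOpens.measurableE R)).
move=> _ [_ [a [b ->] <-]]; rewrite setTI.
by apply: sub_sigma_algebra; apply: cf; exact: interval_open.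
Qed.

Lemma measurable_enorm : measurable_fun [set: B] (@enorm R d : B -> R).
Proof.
apply: (measurableT_comp (continuous_measurable_fun (@sqrt_continuous R))).
apply: measurable_sum => i; apply: measurable_funX.
by apply: measurable_fun_continuous => x; exact: coord_continuous.
Qed.

Lemma Cb_Bb (f : E -> R) : Cb f -> Bb f.
Proof. by case=> /measurable_fun_continuous mf bf; split. Qed.

Lemma Bb_integrable (m : probability B R) (f : E -> R) :
  Bb f -> m.-integrable [set: B] (EFin \o f).
Proof.
case=> mf [M fM]; apply: measurable_bounded_integrable => //.
  by rewrite (le_lt_trans (probability_le1 m measurableT))// ltry.
exists M; split; first exact: num_real.
by move=> y My x _ /=; exact: le_trans (fM x) (ltW My).
Qed.

(** The infimum of the empty set is [0] by default, which is the wrong value when [U] is the whole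
    space; hence the point [y0] outside [U] fixed below. *)
Definition dist_compl (U : set E) (x : E) : R :=
  inf [set `|x - y| | y in ~` U].

Section Proper.
Context (U : set E) (y0 : E) (Uy0 : ~ U y0).

Let dists_lb (x : E) : has_lbound [set `|x - y| | y in ~` U].
Proof. by exists 0 => _ [y _ <-]. Qed.

Let dists_nonempty (x : E) : [set `|x - y| | y in ~` U] !=set0.
Proof. by exists `|x - y0|, y0. Qed.

Lemma dist_compl_ge0 (x : E) : 0 <= dist_compl U x.
Proof. by apply: lb_le_inf => [//|_ [y _ <-]]. Qed.

Lemma dist_compl_eq0 (x : E) : ~ U x -> dist_compl U x = 0.
Proof.
move=> Ux; apply/eqP; rewrite eq_le dist_compl_ge0 andbT.
by apply: ge_inf => //; exists x; rewrite ?subrr ?normr0.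
Qed.

Lemma dist_compl_gt0 (x : E) : open U -> U x -> 0 < dist_compl U x.
Proof.
move=> oU Ux; have /nbhs_normP[e e0 eU] : nbhs x U by exact: open_nbhs_nbhs.
apply: (lt_le_trans e0); apply: lb_le_inf => // _ [y Uy <-].
by rewrite leNgt; apply/negP => xy; apply/Uy/eU.
Qed.

Lemma dist_compl_le (x y : E) : dist_compl U x <= `|x - y| + dist_compl U y.
Proof.
rewrite -lerBlDl; apply: lb_le_inf => // _ [z Uz <-]; rewrite lerBlDl.
rewrite (le_trans _ (ler_normD _ _))//.
by apply: ge_inf => //; exists z; rewrite ?subrKA.
Qed.

Lemma dist_compl_continuous : continuous (dist_compl U).
Proof.
move=> x.
apply: (iffRL (@cvgrPdist_le R R E (nbhs x) _ (dist_compl U) _)) => e e0.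
have xe : \forall y \near x, `|x - y| <= e by apply/nbhs_normP; exists e => //= y /ltW.
move: xe; apply: filterS => y xe.
have := dist_compl_le x y; have := dist_compl_le y x; rewrite (distrC y x).
by rewrite ler_norml; lra.
Qed.

(** Continuous functions increasing with [n] to the indicator of [U] when [U] is open: they vanish
    off [U], and at a point of [U] they equal 1 once [n] exceeds the inverse of its distance to the
    complement. *)
Definition bump (n : nat) (x : E) : R := Num.min 1 (n%:R * dist_compl U x).

Lemma bump_itv (n : nat) (x : E) : 0 <= bump n x <= 1.
Proof.
rewrite /bump le_min ler01 mulr_ge0 ?dist_compl_ge0//=.
by rewrite ge_min lexx.
Qed.

Lemma bump_Cb (n : nat) : Cb (bump n).
Proof.
split=> [x|]; last first.
  by exists 1 => x; have /andP[b0 b1] := bump_itv n x; rewrite ger0_norm.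
apply: (@continuous_min R E (cst 1) (fun y => n%:R * dist_compl U y)).
  exact: cst_continuous.
by apply: continuousM; [exact: cst_continuous|exact: dist_compl_continuous].
Qed.

Lemma bump_cvg (x : E) : open U -> bump n x @[n --> \oo] --> (\1_U x : R).
Proof.
move=> oU; have [Ux|Ux] := pselect (U x); last first.
  rewrite indicE memNset//; apply: cvg_near_cst; near=> n.
  by rewrite /bump dist_compl_eq0// mulr0 min_r.
rewrite indicE mem_set//; apply: cvg_near_cst; near=> n.
rewrite /bump min_l// -ler_pdivrMr ?dist_compl_gt0// div1r.
by near: n; exact: nbhs_infty_ger.
Unshelve. all: by end_near. Qed.

(** Dominated convergence, with the constant 1 as majorant. *)
Lemma integral_bump_cvg (m : probability B R) : open U ->
  (\int[m]_x (bump n x)%:E)%E @[n --> \oo] --> m U.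
Proof.
move=> oU.
have mU : measurable (U : set B) by exact: sub_sigma_algebra.
have <- : (\int[m]_x (\1_U x)%:E = m U)%E by rewrite integral_indic// setIT.
apply: (@dominated_cvg _ _ _ _ _ _ _ _ (cst 1%:E)) => //=.
- move=> n; apply/measurable_EFinP.
  by have [] := Cb_Bb (bump_Cb n).
- by move=> x _; apply: cvg_EFin; [near=> n|exact: bump_cvg].
- exact: finite_measure_integrable_cst.
- move=> n x _; have /andP[b0 b1] := bump_itv n x.
  by rewrite lee_fin ger0_norm.
Unshelve. all: by end_near. Qed.

End Proper.

(** The open sets are stable under intersection and generate the Borel sets, so it suffices to
    compare the measures on them. There both values are limits of the same sequence of integrals of
    bumps. *)
Lemma probability_eq_of_Cb (m1 m2 : probability B R) :
  (forall f, Cb f -> (\int[m1]_x (f x)%:E = \int[m2]_x (f x)%:E)%E) ->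
  forall A : set B, measurable A -> m1 A = m2 A.
Proof.
move=> m12 A mA.
apply: (@measure_unique _ R B (@open E) (fun=> setT)
  _ _ _ _ m1 m2 _ _ A mA) => //.
- by move=> U V; exact: openI.
- by move=> _; exact: openT.
- by rewrite bigcup_const//; exists 0%N.
(* The whole space, which has no bumps, is settled by the total mass 1. *)
- move=> U oU; have [[y0 Uy0]|UT] := pselect (exists y, ~ U y); last first.
    have -> : U = [set: E].
      apply/seteqP; split=> // x _; apply: contrapT => Ux.
      by apply: UT; exists x.
    exact: etrans (probability_setT m1) (esym (probability_setT m2)).
  have cvg1 := @integral_bump_cvg U y0 Uy0 m1 oU.
  rewrite (_ : (fun n => _) = fun n => (\int[m2]_x (bump U n x)%:E)%E) in cvg1.
    have cvg2 := @integral_bump_cvg U y0 Uy0 m2 oU.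
    exact: (cvg_unique (@ereal_hausdorff R) cvg1 cvg2).
  by apply/funext => n; rewrite m12//; exact: (bump_Cb Uy0).
- move=> _.
  have mT : measurable [set: B] by exact: measurableT.
  exact: le_lt_trans (probability_le1 m1 mT) (ltry 1).
Qed.

End Measures.

(** * Long-time behaviour of the integrals against an evolution system *)

Section Decay.
Context {R : realType} {d : nat}.
Local Notation E := 'rV[R]_d.
Local Notation B := (borelRd R d).

(** The pointwise bound [min_le_powR] is integrated against [m]. The right-hand side has a
    nonnegative integrand, so the moment may be infinite. *)
Lemma integral_near_value (m : probability B R) (g : E -> R) (p eps M K : R) :
  0 < p -> 0 < eps -> 0 <= K -> Bb g ->
  (forall x, `|g x - g 0| <= M) -> (forall x, `|g x - g 0| <= K * enorm x) ->
  (`|\int[m]_x (g x)%:E - (g 0)%:E|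
    <= eps%:E + (M * (K / eps) `^ p)%:E * moment m p)%E.
Proof.
move=> p0 e0 K0 Bg gM gK.
have M0 : 0 <= M := le_trans (normr_ge0 _) (gM 0).
have mg : measurable_fun [set: B] (fun x : B => (g x - g 0)%:E).
  by apply/measurable_EFinP; apply: measurable_funB => //; case: Bg.
have men : measurable_fun [set: B] (fun x : B => (enorm (x : E) `^ p)%:E).
  apply/measurable_EFinP.
  exact: (measurableT_comp (measurable_powR p) measurable_enorm).
(* Total mass 1 lets the value [g 0] be moved under the integral. *)
have cint (c : R) : (\int[m]_x c%:E = c%:E)%E.
  rewrite integral_cst// [X in (_ * X)%E](_ : _ = 1%E) ?mule1//.
  exact: probability_setT m.
have -> : (\int[m]_x (g x)%:E - (g 0)%:E = \int[m]_x (g x - g 0)%:E)%E.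
  rewrite -[X in (_ - X)%E]cint -integralB//; first exact: Bb_integrable.
  exact: finite_measure_integrable_cst.
apply: (le_trans (le_abse_integral m measurableT mg)).
have -> : (eps%:E + (M * (K / eps) `^ p)%:E * moment m p =
    \int[m]_x (eps%:E + (M * (K / eps) `^ p)%:E * (enorm (x : E) `^ p)%:E))%E.
  rewrite ge0_integralD//=.
  - rewrite cint ge0_integralZl//.
      by move=> x _; rewrite lee_fin powR_ge0.
    by rewrite lee_fin mulr_ge0 ?powR_ge0.
  - by move=> x _; rewrite lee_fin ltW.
  - by move=> x _; rewrite -EFinM lee_fin !mulr_ge0 ?powR_ge0.
  - exact: measurable_funeM.
apply: ge0_le_integral => //=.
- exact: measurableT_comp (@abse_measurable R setT) mg.
- by apply: emeasurable_funD => //; exact: measurable_funeM.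
- move=> x _; rewrite -EFinM -EFinD lee_fin.
  by apply: min_le_powR => //; exact: enorm_ge0.
Qed.

(** Continuity within the closed time range becomes ordinary joint continuity on the open set of
    times beyond [s]; composing with [y |-> (t, y)] gives the slice. *)
Lemma bounded_classical_solution_continuous
    (q : R -> E -> 'M[R]_d) (b : R -> E -> E) (s : R) (f : E -> R)
    (u : R -> E -> R) (t : R) :
  bounded_classical_solution q b s f u -> s < t -> continuous (u t).
Proof.
case=> uc _ _ _ _ st x.
have tx : (t, x) \in `]s, +oo[%classic `*` [set: E].
  by rewrite inE; split => //=; rewrite in_itv/= st.
have oD : open (`]s, +oo[%classic `*` [set: E] : set (R * E)).
  rewrite (_ : _ `*` _ = (@fst R E) @^-1` `]s, +oo[%classic).
    apply: open_comp; last exact: interval_open.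
    by move=> z _; exact: cvg_fst.
  by apply/seteqP; split=> [z []|z] /=.
have {}uc : {within `]s, +oo[%classic `*` [set: E],
    continuous (fun z : R * E => u z.1 z.2)}.
  apply: continuous_subspaceW uc => z [/= zs _]; split => //.
  by move: zs; rewrite /= !in_itv/= !andbT => /ltW.
rewrite continuous_open_subspace// in uc.
have pc : {for x, continuous (fun y : E => (t, y))}.
  have ct : (fun=> t) y @[y --> x] --> t := @cst_continuous E R t x.
  have cx : y @[y --> x] --> x by move=> A.
  exact: (@cvg_pair _ _ _ (nbhs x) _ _ (nbhs_filter x) _ _ _ _ ct cx).
exact: (continuous_comp pc (uc _ tx)).
Qed.

Lemma evolution_system_integral_near_value
    (I : set R) (q : R -> E -> 'M[R]_d) (b : R -> E -> E)
    (G : R -> R -> (E -> R) -> (E -> R)) (omega C : R)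
    (mu : R -> probability B R) (s : R) (f : E -> R) :
  (forall t, s <= t -> I t) ->
  bounded_classical_solution q b s f (fun t => G t s f) ->
  0 <= C ->
  (forall t, s + 1 <= t ->
    (sup_grad (G t s f) <= (C * expR (omega * (t - s)))%:E * sup_norm f)%E) ->
  Cb f ->
  evolution_system_of_measures I G mu -> moment_decay omega mu ->
  forall eps, 0 < eps -> \forall t \near +oo,
    (`|\int[mu s]_x (f x)%:E - (G t s f 0)%:E| <= eps%:E)%E.
Proof.
move=> Is sol C0 hgrad fC hmu [p p0 hp] eps0 eps0_gt0.
(* One half of [eps0] is for the constant term, the other for the moment term. *)
pose eps := eps0 / 2; have e0 : 0 < eps by rewrite divr_gt0.
(* [N] bounds the whole solution, hence also its initial value [f]. *)
have [_ [N uN] [uD _ _ _ _] _ us] := sol.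
have fN x : `|f x| <= N by rewrite -[f]us uN.
have N0 : 0 <= N := le_trans (normr_ge0 _) (fN 0).
(* [A] is the time-independent part of [K / eps], with [K] the Lipschitz constant below:
   [K / eps = A * expR (omega * t)]. The [p]-th power then produces the weight
   [expR (omega * p * t)] of [moment_decay]. *)
pose A := d%:R * (C * expR (- (omega * s)) * N) / eps.
have A0 : 0 <= A by rewrite !mulr_ge0 ?expR_ge0 ?invr_ge0 ?(ltW e0).
have lim0 : (((2 * N) * A `^ p)%:E *
    (moment (mu t) p * (expR (omega * p * t))%:E))%E @[t --> +oo] --> 0%E.
  by rewrite -[X in _ --> X](mule0 ((2 * N) * A `^ p)%:E); exact: cvgeZl.
have small : nbhs (0 : \bar R) [set y | (y < eps%:E)%E].
  exact: (@nbhs_open_ereal_lt _ 0 (fun=> eps)).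
have := lim0 _ small; rewrite near_simpl => lim_small.
near=> t.
have st : s + 1 <= t by near: t; apply: nbhs_pinfty_ge; exact: num_real.
have lt_st : s < t by rewrite (lt_le_trans _ st)// ltrDl.
pose K := d%:R * (C * expR (omega * (t - s)) * N).
have K0 : 0 <= K by rewrite !mulr_ge0 ?expR_ge0.
have gN x : `|G t s f x| <= N by apply: uN; exact: ltW.
have Bg : Bb (G t s f).
  by apply: Cb_Bb; split;
    [exact: bounded_classical_solution_continuous sol lt_st|exists N].
have partial_le i x : `|pd1 i (G t s f) x| <= C * expR (omega * (t - s)) * N.
  apply: partial_le_sup_grad; apply: (le_trans (hgrad _ st)).
  by rewrite (EFinM _ N) lee_wpmul2l ?lee_fin ?mulr_ge0 ?expR_ge0// sup_norm_le.
have gK x : `|G t s f x - G t s f 0| <= K * enorm x.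
  apply: lipschitz_of_partials => // i y.
  have [|_ + _] := uD t y; last exact.
  by rewrite /= in_itv/= lt_st.
have g2N x : `|G t s f x - G t s f 0| <= 2 * N.
  by rewrite (le_trans (ler_normB _ _))// mulr_natl mulr2n lerD.
(* Invariance replaces the integral of [f] against [mu s] by that of [G t s f] against [mu t]. *)
rewrite -(hmu s t)//; [|exact: Is|apply: Is; exact: ltW|exact: Cb_Bb].
apply: (le_trans (integral_near_value (mu t) p0 e0 K0 Bg g2N gK)).
have -> : K / eps = A * expR (omega * t).
  rewrite /K /A (_ : omega * (t - s) = - (omega * s) + omega * t); last by ring.
  by rewrite expRD; ring.
rewrite powRM ?expR_ge0// -expRM (mulrAC omega) mulrA (EFinM (2 * N * A `^ p)) -muleA.
rewrite [X in (_ + X)%E](_ : _ = ((2 * N * A `^ p)%:E *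
    (moment (mu t) p * (expR (omega * p * t))%:E))%E); last first.
  by rewrite [(moment _ _ * _)%E]muleC.
rewrite (splitr eps0) EFinD leeD2l// ltW//; near: t.
exact: lim_small.
Unshelve. all: by end_near. Qed.

End Decay.

Theorem corollary5p7 (R : realType) (d : nat) (hd : (1 <= d)%N)
    (I : set R) (hI : line_or_right_halfline I)
    (q : R -> 'rV[R]_d -> 'M[R]_d) (b : R -> 'rV[R]_d -> 'rV[R]_d)
    (h1 : holder_coefficients q b I)
    (h2 : uniformly_elliptic q I)
    (h3 : lyapunov_condition q b I)
    (G : R -> R -> ('rV[R]_d -> R) -> ('rV[R]_d -> R))
    (hG : evolution_operator q b I G)
    (omega C : R) (homega : omega < 0) (hC : 0 < C)
    (hgrad : forall (s t : R) (f : 'rV[R]_d -> R),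
       I s -> s + 1 <= t -> Cb f ->
       (sup_grad (G t s f) <= (C * expR (omega * (t - s)))%:E * sup_norm f)%E)
    (hex : exists mu : R -> probability (borelRd R d) R,
       evolution_system_of_measures I G mu /\ moment_decay omega mu) :
  forall mu nu : R -> probability (borelRd R d) R,
    evolution_system_of_measures I G mu -> moment_decay omega mu ->
    evolution_system_of_measures I G nu -> moment_decay omega nu ->
    forall t : R, I t ->
    forall A : set (borelRd R d), measurable A -> mu t A = nu t A.
Proof.
move=> mu nu hmu dmu hnu dnu s Is; apply: probability_eq_of_Cb => f fC.
have Ist t : s <= t -> I t.
  case: hI Is => [->//|[a [|]] ->]; rewrite /= !in_itv/= !andbT.
    exact: le_trans.
  exact: lt_le_trans.
(* Each system is treated on its own, so the exponents [p] of [mu] and [nu] may differ. *)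
have near_value (m : R -> probability (borelRd R d) R) :=
  evolution_system_integral_near_value (mu := m) Ist (hG.1 s f Is fC) (ltW hC)
    (fun t st => hgrad s t f Is st fC) fC.
have fin (m : probability (borelRd R d) R) : (\int[m]_x (f x)%:E)%E \is a fin_num.
  by apply: integrable_fin_num => //; exact: Bb_integrable (Cb_Bb fC).
rewrite -[LHS]fineK// -[RHS]fineK//; congr (_%:E).
(* The two integrals differ by at most any [e > 0]: at one large [t], both are within [e / 2] of the
   common value [G t s f 0]. *)
apply/eqP; rewrite -subr_eq0 -normr_le0; apply/ler_addgt0Pr => e e0.
have e2 : 0 < e / 2 by rewrite divr_gt0.
near (+oo : set_system R) => t.
have : (`|\int[mu s]_x (f x)%:E - (G t s f 0)%:E| <= (e / 2)%:E)%E.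
  by near: t; exact: near_value.
have : (`|\int[nu s]_x (f x)%:E - (G t s f 0)%:E| <= (e / 2)%:E)%E.
  by near: t; exact: near_value.
rewrite -[X in (`|X - _|)%E]fineK// -EFinB abse_EFin lee_fin => nu_le.
rewrite -[X in (`|X - _|)%E]fineK// -EFinB abse_EFin lee_fin => mu_le.
by move: nu_le mu_le; rewrite add0r !ler_norml; lra.
Unshelve. all: by end_near. Qed.
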